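(* Let $G$ be a completely metrizable topological group with identity $e$, let $d$ be a left-invariant compatible metric on $G$, let $\rho$ be a left-invariant continuous pseudometric on $G$, and let $T\colon G\to G$ be a continuous endomorphism of $G$. Then the following assertions are equivalent: (1) $T$ admits an irregular point; (2) $T$ admits a Li-Yorke extremely chaotic pair; (3) $T$ is Li-Yorke extremely chaotic; (4) $T$ is Li-Yorke extremely sensitive; (5) the restriction of $T$ to some $T$-invariant closed subgroup $\widetilde{G}$ of $G$ has a dense (in $\widetilde G$) set of irregular points.
   Context: A topological group is completely metrizable if its topology is induced by some complete metric. A compatible metric $d$ on $G$ is a metric inducing the topology of $G$ (not required to be complete). A (pseudo)metric $d$ is left-invariant if $d(zx,zy)=d(x,y)$ for all $x,y,z\in G$. A continuous endomorphism is a continuous group homomorphism $G\to G$. A subset $Y\subset G$ is $T$-invariant if $TY\subset Y$. All ''extreme'' and ''irregular'' notions are with respect to the fixed $\rho$: A point $x\in G$ is irregular for $T$ if $\liminf_{n\to\infty} d(T^nx,e)=0$ and $\limsup_{n\to\infty} \rho(T^nx,e)=\infty$. A pair $(x,y)\in G\times G$ is Li-Yorke extremely chaotic if $\liminf_{n\to\infty}d(T^nx,T^ny)=0$ and $\limsup_{n\to\infty}\rho(T^nx,T^ny)=\infty$. $T$ is Li-Yorke extremely chaotic if there exists an uncountable set $K\subset G$ such that any two distinct points of $K$ form a Li-Yorke extremely chaotic pair. $T$ is Li-Yorke extremely sensitive if for every $x\in G$ and $\varepsilon>0$ there exists $y\in G$ with $d(x,y)<\varepsilon$ such that $(x,y)$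 is Li-Yorke extremely chaotic. *)

(* Defs.v *)
From HB Require Import structures.
From mathcomp Require Import all_boot all_order all_algebra.
From mathcomp Require Import boolp classical_sets cardinality reals ereal.
From mathcomp Require Import topology normedtype sequences.

Set Implicit Arguments.
Unset Strict Implicit.
Unset Printing Implicit Defensive.

Import Order.TTheory GRing.Theory Num.Theory.
Import numFieldNormedType.Exports.

Local Open Scope classical_set_scope.
Local Open Scope ring_scope.

HB.mixin Record isTopologicalGroup G & Topological G & Group G := {
  mulg_continuous : continuous (fun p : G * G => (p.1 * p.2)%g) ;
  invg_continuous : continuous (fun x : G => (x^-1)%g)
}.

#[short(type="topologicalGroupType")]
HB.structure Definition TopologicalGroup :=
  {G of isTopologicalGroup G & Topological G & Group G}.

Section Metrics.
Context {R : realType}.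

Record is_pseudometric {X : Type} (d : X -> X -> R) : Prop := IsPseudometric {
  pm_ge0 : forall x y, 0 <= d x y ;
  pm_refl : forall x, d x x = 0 ;
  pm_sym : forall x y, d x y = d y x ;
  pm_triangle : forall x y z, d x z <= d x y + d y z
}.

Definition is_metric {X : Type} (d : X -> X -> R) : Prop :=
  is_pseudometric d /\ forall x y, d x y = 0 -> x = y.

Definition induces_topology {X : topologicalType} (d : X -> X -> R) : Prop :=
  forall (x : X) (A : set X),
    nbhs x A <-> exists2 e : R, 0 < e & [set y | d x y < e] `<=` A.

Definition compatible_metric {X : topologicalType} (d : X -> X -> R) : Prop :=
  is_metric d /\ induces_topology d.

Definition cauchy_for {X : Type} (d : X -> X -> R) (u : nat -> X) : Prop :=
  forall e : R, 0 < e ->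
    exists N : nat, forall m n, (N <= m)%N -> (N <= n)%N -> d (u m) (u n) < e.

Definition complete_for {X : Type} (d : X -> X -> R) : Prop :=
  forall u : nat -> X, cauchy_for d u ->
    exists l : X, (fun n => d (u n) l) @ \oo --> (0 : R).

Definition left_invariant {G : groupType} (d : G -> G -> R) : Prop :=
  forall x y z : G, d (z * x)%g (z * y)%g = d x y.

Definition continuous_pseudometric {X : topologicalType}
    (rho : X -> X -> R) : Prop :=
  is_pseudometric rho /\ continuous (fun p : X * X => rho p.1 p.2).

End Metrics.

(* The complete metric need not be left-invariant. *)
Definition completely_metrizable (R : realType) (X : topologicalType) : Prop :=
  exists2 d : X -> X -> R, compatible_metric d & complete_for d.

Section Chaos.
Context {R : realType} {G : topologicalGroupType}.
Variables (d rho : G -> G -> R) (T : G -> G).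

Definition irregular_point (x : G) : Prop :=
  limn_einf (fun n => (d (iter n T x) 1%g)%:E) = 0%E /\
  limn_esup (fun n => (rho (iter n T x) 1%g)%:E) = +oo%E.

Definition LY_extremely_chaotic_pair (x y : G) : Prop :=
  limn_einf (fun n => (d (iter n T x) (iter n T y))%:E) = 0%E /\
  limn_esup (fun n => (rho (iter n T x) (iter n T y))%:E) = +oo%E.

Definition LY_extremely_chaotic : Prop :=
  exists K : set G, ~ countable K /\
    forall x y, K x -> K y -> x <> y -> LY_extremely_chaotic_pair x y.

Definition LY_extremely_sensitive : Prop :=
  forall (x : G) (e : R), 0 < e ->
    exists y : G, d x y < e /\ LY_extremely_chaotic_pair x y.

(* A point of H is irregular for the restriction of T to H (with the restricted
   d and rho) iff it is irregular for T, its orbit being the same; and a subset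
   of H is dense in the subspace H iff H lies in its closure. *)
Definition dense_irregular_in (H : set G) : Prop :=
  H `<=` closure (H `&` [set x | irregular_point x]).

End Chaos.

Definition closed_subgroup {G : topologicalGroupType} (H : set G) : Prop :=
  group_closed (mem H) /\ closed H.

Definition invariant_set {X : Type} (T : X -> X) (H : set X) : Prop :=
  T @` H `<=` H.

(* Main.v *)
Require Import Defs.
From HB Require Import structures.
From mathcomp Require Import all_boot all_order all_algebra.
From mathcomp Require Import boolp classical_sets cardinality reals ereal.
From mathcomp Require Import topology normedtype sequences.

(** The idea. Left-invariance of the two distances and multiplicativity of [T]
    turn a chaotic pair [(x, y)] into the irregular point [y^-1 * x], so only
    irregular points have to be understood. Let [x] be irregular and choose
    times [phi k >= k] with [T^(phi k) x --> 1]. The points whose orbit tends to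
    [1] along these same times form a [T]-invariant subgroup [G0] containing
    [x]; this is [returning phi].

    - The points [T^(phi k) x] are irregular, being iterates of an irregular
      point, and tend to [1]. Multiplying them by an arbitrary point on the
      left gives sensitivity ([irregular_near1]).
    - If [h] in [G0] is not irregular, then its orbit stays [rho]-bounded, so
      [h * T^(phi k) x] has an unbounded orbit; it lies in [G0], hence is
      irregular, and it tends to [h]. So irregular points are dense in [G0] and
      in its closure [H], a [T]-invariant closed subgroup
      ([irregular_dense_subgroup]).
    - For a sequence [c] in [H], the points [y] of [H] that form a chaotic pair
      with every [c k] make up a countable intersection of relatively open
      sets, each dense because it contains [c k * w] for all irregular [w] in
      [H]. By Baire's theorem, where complete metrizability enters, such a [y]
      exists ([generic_partner]). Hence a maximal scrambled subset of [H],
      given by Zorn's lemma, cannot be enumerated ([irregular_LY_chaotic]).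

    The other implications are translations between pairs and points. *)

Set Implicit Arguments.
Unset Strict Implicit.
Unset Printing Implicit Defensive.

Import Order.TTheory GRing.Theory Num.Theory.
Import numFieldNormedType.Exports.

Local Open Scope classical_set_scope.
Local Open Scope ring_scope.

(** * Lower and upper limits equal to 0 and to infinity *)

Lemma limn_einf_eq0P (R : realType) (u : nat -> R) : (forall n, 0 <= u n) ->
  limn_einf (fun n => (u n)%:E) = 0%E <->
  forall e N, 0 < e -> exists2 n, (N <= n)%N & u n < e.
Proof.
move=> u0.
have -> : limn_einf (fun n => (u n)%:E) = limf_einf (fun n => (u n)%:E) \oo.
  by [].
rewrite limf_einfE; split => [sup0 e N e0|smallu].
  apply: contrapT => Nex.
  suff : (e%:E <= 0)%E by rewrite lee_fin leNgt e0.
  rewrite -sup0; apply: ereal_sup_ge.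
  exists (ereal_inf [set (u n)%:E | n in [set n | (N <= n)%N]]).
    by exists [set n | (N <= n)%N] => //; exact: nbhs_infty_ge.
  apply: le_ereal_inf_tmp => _ [n /= Nn <-]; rewrite lee_fin leNgt.
  by apply/negP => une; apply: Nex; exists n.
apply/eqP; rewrite eq_le; apply/andP; split.
  apply: ge_ereal_sup => _ [V [N _ NV] <-].
  apply/lee_addgt0Pr => e e0; rewrite add0e.
  have [n Nn une] := smallu e N e0.
  apply: (@le_trans _ _ (u n)%:E); last by rewrite lee_fin ltW.
  by apply: ereal_inf_lbound; exists n => //; exact: NV.
apply: ereal_sup_ge; exists (ereal_inf [set (u n)%:E | n in setT]).
  by exists setT => //; exact: filterT.
by apply: le_ereal_inf_tmp => _ [n _ <-]; rewrite lee_fin.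
Qed.

Lemma limn_esup_eqyP (R : realType) (u : nat -> R) :
  limn_esup (fun n => (u n)%:E) = +oo%E <->
  forall M N, exists2 n, (N <= n)%N & M < u n.
Proof.
rewrite /limn_esup limf_esupE; split => [infy M N|bigu].
  apply: contrapT => Nex.
  suff : (+oo <= M%:E)%E by rewrite leye_eq.
  rewrite -infy; apply: ereal_inf_le.
  exists (ereal_sup [set (u n)%:E | n in [set n | (N <= n)%N]]).
    by exists [set n | (N <= n)%N] => //; exact: nbhs_infty_ge.
  apply: ge_ereal_sup => _ [n /= Nn <-]; rewrite lee_fin leNgt.
  by apply/negP => une; apply: Nex; exists n.
apply/eqP; rewrite -leye_eq; apply: le_ereal_inf_tmp => _ [V [N _ NV] <-].
rewrite leye_eq; apply/eqP/eqyP => M _.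
have [n Nn Mun] := bigu M N.
apply: (@le_trans _ _ (u n)%:E); first by rewrite lee_fin ltW.
by apply: ereal_sup_ubound; exists n => //; exact: NV.
Qed.

(** * Baire's theorem in a closed subset of a complete metric space *)

Section Metric.
Context (R : realType) (X : topologicalType) (d : X -> X -> R).

Lemma dist_cts : compatible_metric d -> forall a, continuous (fun x => d x a).
Proof.
move=> [[pd _] top] a x; apply/cvgrPdist_lt => e e0.
apply/top; exists e => //= y xy.
rewrite ltr_norml; apply/andP; split.
  rewrite ltrBrDr addrC ltrBlDr.
  by rewrite (le_lt_trans (pm_triangle pd y x a))// (pm_sym pd) addrC ltrD2l.
rewrite ltrBlDr.
by rewrite (le_lt_trans (pm_triangle pd x y a))// ltrD2r.
Qed.

(** The usual nested balls, with all centers taken in [H]. The distance [d] is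
    an arbitrary complete one: in the application it need not be the
    left-invariant distance. *)
Lemma Baire_closed (I : countType) (H : set X) (U : I -> set X) :
  compatible_metric d -> complete_for d -> closed H -> H !=set0 ->
  (forall i, open (U i)) -> (forall i, H `<=` closure (H `&` U i)) ->
  exists2 x, H x & forall i, U i x.
Proof.
move=> cd complete clH [x0 Hx0] oU dU.
have [[pd _] top] := cd.
(* Codes of no index contribute the trivial condition. *)
pose V n := if unpickle n is Some i then U i else setT.
have oV n : open (V n) by rewrite /V; case: unpickle => //; exact: openT.
have dV n : H `<=` closure (H `&` V n).
  rewrite /V; case: unpickle => // x Hx; rewrite setIT; exact: subset_closure.
(* A stage is a pair (center, radius); the next closed ball lies inside both
   [V n] and the current open ball, and its radius is at most 1/(n+1). *)
pose ok (p : X * R) := H p.1 /\ 0 < p.2.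
have step (np : nat * (X * R)) : exists q : X * R, ok np.2 ->
    [/\ ok q, q.2 <= np.1.+1%:R^-1 &
     forall z, d q.1 z <= q.2 -> V np.1 z /\ d np.2.1 z < np.2.2].
  case: np => n [x r] /=; have [[/= Hx r0]|] := pselect (ok (x, r)); last first.
    by move=> nok; exists (x, r).
  have [|y [[Hy Vy] xy]] := dV n x Hx [set y | d x y < r].
    by apply/top; exists r.
  have : nbhs y (V n `&` [set z | d x z < r]).
    apply: filterI; first exact: open_nbhs_nbhs.
    apply/top; exists (r - d x y); first by rewrite subr_gt0.
    move=> z /= yz; rewrite (le_lt_trans (pm_triangle pd x y z))//.
    by rewrite -ltrBrDl.
  move=> /top[s s0 sV].
  (* Halving makes the closed ball fit in the open ball of radius [s]. *)
  exists (y, Num.min (s / 2) n.+1%:R^-1) => _; split => /=.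
  - by split => //=; rewrite lt_min divr_gt0//= invr_gt0.
  - by rewrite ge_min lexx orbT.
  - move=> z; rewrite le_min => /andP[yz _]; apply: sV => /=.
    by rewrite (le_lt_trans yz)// ltr_pdivrMr// ltr_pMr// ltr1n.
have [f fP] := choice step.
pose p := fix p n := if n is m.+1 then f (m, p m) else (x0, 1).
have okp n : ok (p n).
  by elim: n => [|n /(fP (n, p n))[]//]; split => /=.
have pS n : (p n.+1).2 <= n.+1%:R^-1 /\
    forall z, d (p n.+1).1 z <= (p n.+1).2 -> V n z /\ d (p n).1 z < (p n).2.
  by have /(fP (n, p n))[] := okp n.
have nested n k z : d (p (k + n)%N).1 z <= (p (k + n)%N).2 ->
    d (p n).1 z <= (p n).2.
  elim: k => // k IH /(proj2 (pS _))[_ /ltW]; exact: IH.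
have inball n m : (n <= m)%N -> d (p n).1 (p m).1 <= (p n).2.
  move=> /subnK mE; apply: (@nested n (m - n)%N); rewrite mE (pm_refl pd).
  by have [_ /ltW] := okp m.
have [|l lim] := complete (fun n => (p n).1).
  move=> e e0.
  have [N _ /(_ N (leqnn _)) Ne] : \forall n \near \oo, n.+1%:R^-1 < e / 2.
    have e2 : 0 < e / 2 by rewrite divr_gt0.
    exact: (near_infty_natSinv_lt (PosNum e2)).
  exists N.+1 => m n Nm Nn.
  have small k : (N.+1 <= k)%N -> d (p N.+1).1 (p k).1 < e / 2.
    by move=> /inball/le_lt_trans; apply; exact: le_lt_trans (proj1 (pS N)) Ne.
  rewrite (le_lt_trans (pm_triangle pd _ (p N.+1).1 _))// [e]splitr.
  by rewrite ltrD// ?small// (pm_sym pd) small.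
have lball n : d (p n).1 l <= (p n).2.
  apply/ler_addgt0Pr => e e0.
  move/cvgrPdist_lt : lim => /(_ e e0)[N _ /(_ (maxn N n) (leq_maxl _ _))].
  rewrite sub0r normrN ger0_norm ?(pm_ge0 pd)// => /ltW le.
  rewrite (le_trans (pm_triangle pd _ (p (maxn N n)).1 _))//.
  by rewrite lerD// inball// leq_maxr.
exists l.
  apply: clH => B /top[e e0 eB].
  move/cvgrPdist_lt : lim => /(_ e e0)[N _ /(_ N (leqnn _))].
  rewrite sub0r normrN ger0_norm ?(pm_ge0 pd)// => le.
  exists (p N).1; split; first by have [] := okp N.
  by apply: eB => /=; rewrite (pm_sym pd).
move=> i; have [+ _] := proj2 (pS (pickle i)) l (lball _).
by rewrite /V pickleK.
Qed.

End Metric.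

(** * Topological groups *)

Section TopologicalGroup.
Context (G : topologicalGroupType).

Lemma cvgM_group (I : Type) (F : set_system I) (FF : Filter F) (u v : I -> G)
  (a b : G) : u @ F --> a -> v @ F --> b ->
  (u i * v i)%g @[i --> F] --> (a * b)%g.
Proof.
move=> ua vb; apply: continuous2_cvg => //; exact: (mulg_continuous (a, b)).
Qed.

Lemma cvgV_group (I : Type) (F : set_system I) (FF : Filter F) (u : I -> G)
  (a : G) : u @ F --> a -> (u i)^-1%g @[i --> F] --> (a^-1)%g.
Proof. by move=> ua; apply: (cvg_comp _ _ ua); exact: invg_continuous. Qed.

Lemma translate_nbhs (a b : G) (B : set G) : nbhs (a * b)%g B ->
  \forall c \near b, B (a * c)%g.
Proof.
by apply: (cvgM_group (F := nbhs b)); [exact: cvg_cst|exact: cvg_id].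
Qed.

Lemma closure_group_closed (H : set G) :
  group_closed (mem H) -> closed_subgroup (closure H).
Proof.
move=> [/set_mem H1 HB]; split; last exact: closed_closure.
split; first by apply/mem_set; exact: subset_closure.
move=> x y /set_mem Hx /set_mem Hy; apply/mem_set => B.
have : (p.1 * p.2^-1)%g @[p --> (x, y)] --> (x * y^-1)%g.
  by apply: cvgM_group; [exact: cvg_fst|apply: cvgV_group; exact: cvg_snd].
move=> /[apply] -[[A1 A2] [/Hx[a [Ha Aa]] /Hy[b [Hb Ab]]] AB].
exists (a * b^-1)%g; split; last exact: (AB (a, b)).
by apply/set_mem/HB; exact/mem_set.
Qed.

End TopologicalGroup.

(** * Chaotic pairs and irregular points *)

Section Chaos.
Context (R : realType) (G : topologicalGroupType).
Context (d rho : G -> G -> R) (T : {multiplicative G -> G}).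
Hypotheses (cd : compatible_metric d) (dinv : left_invariant d).
Hypotheses (crho : continuous_pseudometric rho) (rhoinv : left_invariant rho).
Hypothesis cT : continuous T.

Let pd : is_pseudometric d. Proof. by case: cd => -[]. Qed.
Let prho : is_pseudometric rho. Proof. by case: crho. Qed.

Lemma iterM n : {morph iter n T : x y / (x * y)%g}.
Proof. by elim: n => // n IH x y; rewrite !iterS IH gmulfM. Qed.

Lemma iter1 n : iter n T 1%g = 1%g.
Proof.
elim: n => // n; rewrite iterS => ->.
by apply: (@mulgI _ (T 1%g)); rewrite -gmulfM !mulg1.
Qed.

Lemma iter_cts n : continuous (iter n T).
Proof.
elim: n => [|n IH] x; first exact: cvg_id.
by apply: (cvg_comp _ _ (IH x)); exact: cT.
Qed.

Lemma chaotic_pairP x y : LY_extremely_chaotic_pair d rho T x y <->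
  (forall e N, 0 < e ->
     exists2 n, (N <= n)%N & d (iter n T x) (iter n T y) < e) /\
  (forall M N, exists2 n, (N <= n)%N & M < rho (iter n T x) (iter n T y)).
Proof.
have liminfP := @limn_einf_eq0P R (fun n => d (iter n T x) (iter n T y))
  (fun n => pm_ge0 pd _ _).
have limsupP := @limn_esup_eqyP R (fun n => rho (iter n T x) (iter n T y)).
by split=> -[/liminfP ? /limsupP ?]; split.
Qed.

Lemma irregular_pair x :
  irregular_point d rho T x = LY_extremely_chaotic_pair d rho T x 1%g.
Proof.
rewrite /irregular_point /LY_extremely_chaotic_pair.
by congr (_ /\ _);
  [congr (limn_einf _ = _)|congr (limn_esup _ = _)]; apply/funext => n;
  rewrite iter1.
Qed.

Lemma chaotic_pairM z x y :
  LY_extremely_chaotic_pair d rho T (z * x)%g (z * y)%g =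
  LY_extremely_chaotic_pair d rho T x y.
Proof.
rewrite /LY_extremely_chaotic_pair.
by congr (_ /\ _);
  [congr (limn_einf _ = _)|congr (limn_esup _ = _)]; apply/funext => n;
  rewrite !iterM (dinv, rhoinv).
Qed.

Lemma chaotic_pairC x y : LY_extremely_chaotic_pair d rho T x y ->
  LY_extremely_chaotic_pair d rho T y x.
Proof.
move=> /chaotic_pairP[small big]; apply/chaotic_pairP; split=> [e N e0|M N].
  by have [n Nn dn] := small e N e0; exists n; rewrite // (pm_sym pd).
by have [n Nn dn] := big M N; exists n; rewrite // (pm_sym prho).
Qed.

Lemma not_chaotic_pairxx x : ~ LY_extremely_chaotic_pair d rho T x x.
Proof.
move=> /chaotic_pairP[_ /(_ 0 0%N)[n _]].
by rewrite (pm_refl prho) ltxx.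
Qed.

Lemma chaotic_pair_irregular x y : LY_extremely_chaotic_pair d rho T x y ->
  irregular_point d rho T (y^-1 * x)%g.
Proof.
by move=> xy; rewrite irregular_pair -(chaotic_pairM y) mulVKg mulg1.
Qed.

(** * Points returning to the identity along fixed times *)

(** Fixing the times [phi] in advance is what makes this set a subgroup:
    two points whose orbits come close to [1] at unrelated times may have a
    product whose orbit does not. *)
Definition returning (phi : nat -> nat) : set G :=
  [set x | iter (phi k) T x @[k --> \oo] --> (1%g : G)].

Lemma returning_group_closed phi : group_closed (mem (returning phi)).
Proof.
split => [|x y].
  apply/mem_set; rewrite /returning /=.
  by under eq_fun do rewrite iter1; exact: cvg_cst.
move=> /set_mem rx /set_mem ry; apply/mem_set; rewrite /returning /=.
have iterV n : iter n T y^-1%g = (iter n T y)^-1%g.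
  by apply/esym/mulg1_eq; rewrite -iterM mulgV iter1.
under eq_fun do rewrite iterM iterV.
by have := cvgM_group _ rx (cvgV_group _ ry); rewrite invg1 mulg1; apply.
Qed.

Lemma returning_iter phi n x : returning phi x -> returning phi (iter n T x).
Proof.
rewrite /returning /= => rx.
under eq_fun do rewrite -iterD addnC iterD.
rewrite -(iter1 n); apply: cvg_comp rx _; exact: iter_cts.
Qed.

Lemma irregular_returning x : irregular_point d rho T x ->
  exists2 phi, (forall k, (k <= phi k)%N) & returning phi x.
Proof.
rewrite irregular_pair => /chaotic_pairP[small _].
have [|phi phiP] := @choice nat nat (fun k n =>
    (k <= n)%N /\ d (iter n T x) (iter n T 1%g) < k.+1%:R^-1).
  move=> k.
  by have [|n kn dn] := small k.+1%:R^-1 k; [rewrite invr_gt0|exists n].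
exists phi => [k|]; first by have [] := phiP k.
move=> B /(proj2 cd)[e e0 eB].
apply: filterS (near_infty_natSinv_lt (PosNum e0)) => k /= ke; apply: eB => /=.
have [_ dk] := phiP k.
by rewrite (pm_sym pd) -(iter1 (phi k)) (lt_trans dk).
Qed.

Lemma returning_irregular phi x :
  (forall k, (k <= phi k)%N) -> returning phi x ->
  (forall M N, exists2 n, (N <= n)%N & M < rho (iter n T x) 1%g) ->
  irregular_point d rho T x.
Proof.
move=> phik rx big; rewrite irregular_pair; apply/chaotic_pairP.
split=> [e N e0|M N]; last first.
  by have [n Nn Mn] := big M N; exists n; rewrite ?iter1.
have [|K _ KP] := rx [set y | d 1%g y < e]; first by apply/(proj2 cd); exists e.
exists (phi (maxn K N)); first by rewrite (leq_trans (leq_maxr K N)).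
by rewrite iter1 (pm_sym pd); apply: KP; exact: leq_maxl.
Qed.

Lemma irregular_iter k x :
  irregular_point d rho T x -> irregular_point d rho T (iter k T x).
Proof.
rewrite !irregular_pair => /chaotic_pairP[small big]; apply/chaotic_pairP.
have tail (P : nat -> Prop) N : (exists2 n, (N + k <= n)%N & P n) ->
    exists2 n, (N <= n)%N & P (n + k)%N.
  move=> [n Nkn Pn]; have kn := leq_trans (leq_addl N k) Nkn.
  by exists (n - k)%N; rewrite ?subnK// leq_subRL ?kn// addnC.
split=> [e N /(small e (N + k)%N)|M N].
  by move=> /tail[n Nn dn]; exists n; rewrite // -iterD iter1 -(iter1 (n + k)).
have /tail[n Nn dn] := big M (N + k)%N.
by exists n; rewrite // -iterD iter1 -(iter1 (n + k)).
Qed.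

(** An irregular [x] perturbs a point [h] with bounded orbit into an irregular
    one: by the triangle inequality, the orbit of [h * T^(phi k) x] is as
    unbounded as that of [x], while both factors return along [phi]. *)
Lemma returning_dense_irregular phi x :
  (forall k, (k <= phi k)%N) -> returning phi x -> irregular_point d rho T x ->
  returning phi `<=`
    closure (returning phi `&` [set y | irregular_point d rho T y]).
Proof.
move=> phik rx ix h rh.
have [irrh|regh] := pselect (irregular_point d rho T h).
  by apply: subset_closure; split.
(* As [h] returns along [phi], it can only fail irregularity by boundedness. *)
have [M [N hM]] : exists M N, forall n, (N <= n)%N -> rho (iter n T h) 1%g <= M.
  apply: contrapT => nb; apply/regh/(returning_irregular phik rh) => M N.
  apply: contrapT => nMN; apply: nb; exists M, N => n Nn.
  by rewrite leNgt; apply/negP => Mn; apply: nMN; exists n.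
move=> B; rewrite -{1}[h]mulg1 => /translate_nbhs/rx.
move=> [k _ /(_ k (leqnn k)) /= Bk].
set z := iter (phi k) T x in Bk.
have rz : returning phi z by exact: returning_iter.
have rhz : returning phi (h * z)%g.
  apply/set_mem/(group_closedM (returning_group_closed phi)); exact/mem_set.
exists (h * z)%g; split=> //; split=> //.
apply: (returning_irregular phik rhz) => M' N'.
have := irregular_iter (phi k) ix; rewrite -/z irregular_pair.
move=> /chaotic_pairP[_ /(_ (M' + M) (maxn N N'))[n]].
rewrite geq_max => /andP[Nn N'n]; rewrite iter1 => bign; exists n => //.
rewrite iterM; set a := iter n T h; set b := iter n T z in bign *.
rewrite -(ltrD2r M) (lt_le_trans bign)//.
have -> : rho b 1%g = rho (a * b)%g a by rewrite -(rhoinv _ _ a) mulg1.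
rewrite (le_trans (pm_triangle prho _ 1%g _))// lerD2l (pm_sym prho).
exact: hM.
Qed.

Lemma irregular_dense_subgroup x : irregular_point d rho T x ->
  exists H, [/\ closed_subgroup H, invariant_set T H &
                dense_irregular_in d rho T H].
Proof.
move=> ix; have [phi phik rx] := irregular_returning ix.
exists (closure (returning phi)); split.
- exact/closure_group_closed/returning_group_closed.
- move=> _ [y cy <-] B /cT/cy[z [rz Bz]]; exists (T z); split=> //.
  exact: (@returning_iter phi 1).
- move=> y cy; apply: closed_closure; apply: (closureS _ cy) => h.
  move=> /(returning_dense_irregular phik rx ix); apply: closureS => z [rz iz].
  by split=> //; exact: subset_closure.
Qed.

Lemma irregular_near1 x e : irregular_point d rho T x -> 0 < e ->
  exists2 z, d 1%g z < e & irregular_point d rho T z.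
Proof.
move=> ix e0; have [phi phik rx] := irregular_returning ix.
have [|k _ /(_ k (leqnn k)) /= kP] := rx [set y | d 1%g y < e].
  by apply/(proj2 cd); exists e.
by exists (iter (phi k) T x) => //; exact: irregular_iter.
Qed.

(** * Uncountable scrambled sets *)

(** For fixed [c k], chaos of [(y, c k)] is a countable conjunction of open
    conditions on [y], indexed below by the required closeness (left summand) or
    separation (right summand). By left translation they hold on the dense set
    of the [c k * w] with [w] irregular. *)
Lemma generic_partner (H : set G) (c : nat -> G) :
  completely_metrizable R G -> closed_subgroup H ->
  dense_irregular_in d rho T H -> (forall k, H (c k)) ->
  exists2 y, H y & forall k, LY_extremely_chaotic_pair d rho T y (c k).
Proof.
move=> [d0 cd0 complete0] [gH clH] dH Hc.
have HM a b : H a -> H b -> H (a * b)%g.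
  move=> Ha Hb; apply/set_mem/(group_closedM gH); exact/mem_set.
have HV a : H a -> H (a^-1)%g.
  by move=> Ha; apply/set_mem/(group_closedV gH); exact/mem_set.
pose U (i : nat * nat + nat * nat) : set G := match i with
  | inl (k, N) => \bigcup_(n in [set n | (N <= n)%N])
      [set y | d (iter n T y) (iter n T (c k)) < N.+1%:R^-1]
  | inr (k, N) => \bigcup_(n in [set n | (N <= n)%N])
      [set y | N%:R < rho (iter n T y) (iter n T (c k))]
  end.
have rho_cts a : continuous (fun x => rho x a).
  move=> x; apply: (cvg_comp (fun x => (x, a)) (fun p => rho p.1 p.2));
    last exact: (proj2 crho (x, a)).
  by apply: cvg_pair; [exact: cvg_id|exact: cvg_cst].
have oU i : open (U i).
  case: i => -[k N]; apply: bigcup_open => n _.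
  - apply: (@open_comp _ _ (fun y => d (iter n T y) (iter n T (c k)))
      [set r | r < N.+1%:R^-1]);
      last exact: open_lt.
    move=> y _; apply: (cvg_comp (iter n T) (d^~ (iter n T (c k)))).
      exact: iter_cts.
    exact: dist_cts.
  - apply: (@open_comp _ _ (fun y => rho (iter n T y) (iter n T (c k)))
      [set r | N%:R < r]);
      last exact: open_gt.
    move=> y _; apply: (cvg_comp (iter n T) (rho^~ (iter n T (c k)))).
      exact: iter_cts.
    exact: rho_cts.
have dU i : H `<=` closure (H `&` U i).
  pose k := match i with inl (k, _) => k | inr (k, _) => k end.
  move=> h Hh B; rewrite -{1}(mulVKg (c k) h) => /translate_nbhs.
  move=> /(dH _ (HM _ _ (HV _ (Hc k)) Hh))[w [[Hw iw] Bw]].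
  exists (c k * w)%g; split=> //; split; first exact: HM.
  have : LY_extremely_chaotic_pair d rho T (c k * w)%g (c k).
    rewrite -[X in LY_extremely_chaotic_pair _ _ _ _ X]mulg1.
    by rewrite chaotic_pairM -irregular_pair.
  rewrite /k {Bw k} => /chaotic_pairP[]; case: i => -[k N] small big /=.
  - by have [|n Nn dn] := small N.+1%:R^-1 N; [rewrite invr_gt0|exists n].
  - by have [n Nn dn] := big N%:R N; exists n.
have [|y Hy Uy] := Baire_closed cd0 complete0 clH _ oU dU.
  by exists (c 0%N).
exists y => // k; apply/chaotic_pairP; split=> [e N e0|M N].
  have [K _ KP] := near_infty_natSinv_lt (PosNum e0).
  have [n /= Nn dn] := Uy (inl (k, maxn K N)).
  exists n; first by rewrite (leq_trans (leq_maxr K N)).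
  by rewrite (lt_trans dn)//; apply: KP => /=; exact: leq_maxl.
have [K _ KP] := nbhs_infty_gtr M.
have [n /= Nn dn] := Uy (inr (k, maxn K N)).
exists n; first by rewrite (leq_trans (leq_maxr K N)).
by rewrite (lt_trans _ dn)//; apply: KP => /=; exact: leq_maxl.
Qed.

(** A countable scrambled subset of [H] is never maximal: a generic point of [H]
    can be added to it. Such a point is new because no pair [(y, y)] is
    chaotic. *)
Lemma irregular_LY_chaotic x : completely_metrizable R G ->
  irregular_point d rho T x -> LY_extremely_chaotic d rho T.
Proof.
move=> cG /irregular_dense_subgroup[H [sH _ dH]].
pose scrambled (K : set G) := K `<=` H /\ forall x y, K x -> K y -> x <> y ->
  LY_extremely_chaotic_pair d rho T x y.
have [|K [[KH Kpair] Kmax]] := @Zorn_bigcup G scrambled.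
  move=> F FP tot; split=> [y [A FA Ay]|y z [A FA Ay] [B FB Bz]].
    by have [AH _] := FP _ FA; exact: AH.
  have [AB|BA] := tot _ _ FA FB.
    by apply: (proj2 (FP _ FB)) => //; exact: AB.
  by apply: (proj2 (FP _ FA)) => //; exact: BA.
exists K; split=> // /countable_injP[f finj].
(* [c] enumerates [K], taking the value 1, which lies in [H], at unused codes. *)
pose c k := xget 1%g [set a | K a /\ f a = k].
have Hc k : H (c k).
  rewrite /c; case: xgetP => [a _ [Ka _]|_]; first exact: KH.
  by apply/set_mem; case: sH => -[].
have cK a : K a -> c (f a) = a.
  move=> Ka; rewrite /c; case: xgetP => [b _ [Kb /finj]|/(_ a)[]//].
  by apply; exact/mem_set.
have [y Hy yP] := generic_partner cG sH dH Hc.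
have yK a : K a -> LY_extremely_chaotic_pair d rho T y a.
  by move=> Ka; rewrite -(cK a Ka).
apply: (Kmax (K `|` [set y])).
  split; first by move=> a; left.
  by move=> /(_ y (or_intror erefl))/yK/not_chaotic_pairxx.
split=> [a [/KH//|->//]|a b [Ka|->] [Kb|->]].
- exact: Kpair.
- by move=> _; apply/chaotic_pairC/yK.
- by move=> _; exact: yK.
- by [].
Qed.

End Chaos.

Theorem theorem3p25 (R : realType) (G : topologicalGroupType)
    (hG : completely_metrizable R G)
    (d : G -> G -> R) (hd : compatible_metric d) (hdinv : left_invariant d)
    (rho : G -> G -> R) (hrho : continuous_pseudometric rho)
    (hrhoinv : left_invariant rho)
    (T : {multiplicative G -> G}) (hT : continuous T) :
  [<-> exists x : G, irregular_point d rho T x;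
       exists x y : G, LY_extremely_chaotic_pair d rho T x y;
       LY_extremely_chaotic d rho T;
       LY_extremely_sensitive d rho T;
       exists H : set G,
         [/\ closed_subgroup H, invariant_set T H &
             dense_irregular_in d rho T H] ].
Proof.
tfae.
- by move=> [x ix]; exists x, 1%g; rewrite -irregular_pair.
- move=> [x [y /(chaotic_pair_irregular hdinv hrhoinv)]].
  exact: irregular_LY_chaotic.
- move=> [K [uncK Kpair]] x e e0.
  have [a [b /(chaotic_pair_irregular hdinv hrhoinv) iab]] :
      exists a b, LY_extremely_chaotic_pair d rho T a b.
    apply: contrapT => nopair; apply: uncK.
    have [[a Ka]|K0] := pselect (K !=set0); last first.
      by rewrite (_ : K = set0) //; apply/eqP/negPn/negP => /set0P.
    apply: (sub_countable _ (countable1 a)); apply: subset_card_le => b Kb.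
    by apply: contrapT => ba; apply: nopair; exists b, a; exact: Kpair.
  have [z z1 iz] := irregular_near1 hd iab e0.
  exists (x * z)%g; split; first by rewrite -(hdinv 1%g z x) mulg1 in z1.
  apply: (chaotic_pairC hd hrho).
  rewrite -[X in LY_extremely_chaotic_pair _ _ _ _ X]mulg1.
  by rewrite chaotic_pairM// -irregular_pair.
- move=> /(_ 1%g 1 ltr01)[y [_ /(chaotic_pairC hd hrho)]].
  by rewrite -irregular_pair; exact: irregular_dense_subgroup.
- move=> [H [[[/set_mem H1 _] _] _ /(_ _ H1 setT filterT)[x [[_ ix] _]]]].
  by exists x.
Qed.
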